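(* Let $G$ be a $2$-connected graph. If $G$ is claw-o-heavy and $N$-c-heavy, then $G$ is hamiltonian.
   Context: All graphs are finite, simple and undirected. For a graph $G$ on $n=|V(G)|$ vertices, a vertex $v$ is heavy if $d_G(v)\geq n/2$; a pair $\{u,v\}$ of vertices is a heavy pair if $uv\notin E(G)$ and $d_G(u)+d_G(v)\geq n$. $G$ is claw-o-heavy if every induced subgraph of $G$ isomorphic to $K_{1,3}$ contains a heavy pair of $G$. For a graph $S$, $G$ is $S$-c-heavy if for every induced subgraph $G'$ of $G$ isomorphic to $S$ and every maximal clique $C$ of $G'$, every component of $G'-C$ with at least two vertices contains a vertex that is heavy in $G$. $N$ (the net) is the graph obtained from a triangle by attaching one pendant edge to each of its three vertices. *)

(* Defs.v *)
From mathcomp Require Import all_boot.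

Set Implicit Arguments.
Unset Strict Implicit.
Unset Printing Implicit Defensive.

Record sgraph := SGraph {
  vertex :> finType;
  adj : rel vertex;
  adj_sym : symmetric adj;
  adj_irr : irreflexive adj
}.

Definition degree (G : sgraph) (v : G) : nat := #|[set u | adj v u]|.

(* d(v) >= n/2, with the denominator cleared. *)
Definition heavy (G : sgraph) (v : G) : bool := #|G| <= (degree v).*2.

Definition heavy_pair (G : sgraph) (u v : G) : bool :=
  [&& u != v, ~~ adj u v & #|G| <= degree u + degree v].

(* Induced subgraphs are represented by their vertex sets: [iso_induced X S]
   says that G[X] is isomorphic to S. *)
Definition iso_induced (G : sgraph) (X : {set G}) (S : sgraph) : Prop :=
  exists f : S -> G,
    [/\ injective f, f @: [set: S] = X & forall x y, adj (f x) (f y) = adj x y].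

(* Adjacency of the induced subgraph G[X], as a relation on the vertices of G. *)
Definition adj_in (G : sgraph) (X : {set G}) : rel G :=
  [rel u v | [&& u \in X, v \in X & adj u v]].

Definition connected (G : sgraph) (X : {set G}) : Prop :=
  {in X &, forall u v, connect (adj_in X) u v}.

Definition component (G : sgraph) (X K : {set G}) : Prop :=
  exists2 u, u \in X & K = [set v | connect (adj_in X) u v].

Definition clique (G : sgraph) (C : {set G}) : bool :=
  [forall u in C, forall v in C, (u != v) ==> adj u v].

Definition maximal_clique (G : sgraph) (X C : {set G}) : bool :=
  maxset [pred D : {set G} | (D \subset X) && clique D] C.

Definition k_connected (k : nat) (G : sgraph) : Prop :=
  k < #|G| /\ forall X : {set G}, #|X| < k -> connected (~: X).

Definition hamiltonian (G : sgraph) : Prop :=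
  exists c : seq G, [/\ ucycle (@adj G) c, 2 < size c & forall v : G, v \in c].

(* K_{1,3}, with centre [None]. *)
Definition claw_adj : rel (option 'I_3) := [rel x y | isSome x != isSome y].

Lemma claw_sym : symmetric claw_adj.
Proof. by move=> [x|] [y|]. Qed.

Lemma claw_irr : irreflexive claw_adj.
Proof. by case. Qed.

Definition claw : sgraph := SGraph claw_sym claw_irr.

(* [(false, i)] are the triangle vertices; [(true, i)] is the leaf attached to
   [(false, i)]. *)
Definition net_adj : rel (bool * 'I_3) :=
  [rel x y | if x.2 == y.2 then x.1 != y.1 else ~~ x.1 && ~~ y.1].

Lemma net_sym : symmetric net_adj.
Proof. by move=> [a i] [b j]; rewrite /net_adj /= eq_sym; case: ifP; case: a; case: b. Qed.

Lemma net_irr : irreflexive net_adj.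
Proof. by move=> [a i]; rewrite /net_adj /= !eqxx. Qed.

Definition net : sgraph := SGraph net_sym net_irr.

Definition claw_o_heavy (G : sgraph) : Prop :=
  forall X : {set G}, iso_induced X claw ->
  exists u v : G, [/\ u \in X, v \in X & heavy_pair u v].

Definition c_heavy (S G : sgraph) : Prop :=
  forall X : {set G}, iso_induced X S ->
  forall C : {set G}, maximal_clique X C ->
  forall K : {set G}, component (X :\: C) K -> 2 <= #|K| ->
  exists2 v, v \in K & heavy v.

(* Main.v *)
Require Import Defs.
From mathcomp Require Import all_boot.
From mathcomp Require Import zify.

(* A vertex pair is soft if it is an edge or a heavy pair.  By the Bondy-Chvatal
   argument every soft cycle has its vertices on a cycle of G, so a longest cycle
   is also a longest soft cycle.  Suppose that a longest cycle misses a vertex.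
   By 2-connectivity a path p outside the cycle joins two of its vertices, and
   these, viewed as one-vertex hubs, are joined by p and by the two arcs of the
   cycle.  A hub has three ports and enough spanning paths between them to turn
   many extra soft edges into a longer soft cycle.

   Let both hubs swallow vertices of the two arcs for as long as possible.  When
   a hub U cannot grow, the first vertices of the three paths leaving it are
   pairwise non-soft and each has a single soft neighbour in U.  A connected
   graph with three leaves contains an induced claw or an induced net, and in
   either case the heaviness conditions give g <> h in U with d(g) + d(h) >= n.
   The other hub has such a pair g', h' as well.  Adding degrees, two of the four
   pairs between {g, h} and {g', h'} that share a vertex are soft.  But a soft pair
   between the hubs must join corresponding ports, since otherwise there is a soft
   cycle through both hubs and all three paths. *)

Set Implicit Arguments.
Unset Strict Implicit.
Unset Printing Implicit Defensive.

Ltac perm_tac :=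
  apply/permP => q;
  repeat match goal with
  | H : is_true (perm_eq _ _) |- _ => move: H => /permP/(_ q)
  end;
  do 4! rewrite ?(count_cat, count_rev) /=; clear; lia.

(** * Spanning paths, and hubs that absorb new vertices *)

Section SpanningPaths.

Variables (T : eqType) (e : rel T).
Hypothesis e_sym : symmetric e.

Lemma rev_path_rcons a s b : path e a (rcons s b) -> path e b (rcons (rev s) a).
Proof.
move=> h; have := rev_path e a (rcons s b).
rewrite last_rcons belast_rcons rev_cons => ->.
by rewrite (eq_path (e' := e)) // => u v; rewrite /= e_sym.
Qed.

(** Only the multiset of vertices is recorded, so that paths can be glued without keeping track of
    their order. *)
Definition spans (l : seq T) (a b : T) :=
  exists s, [/\ path e a s, last a s = b & perm_eq (a :: s) l].

Lemma spans_perm l l' a b : perm_eq l l' -> spans l a b -> spans l' a b.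
Proof. by move=> ll' [s [p ls sl]]; exists s; split=> //; exact: perm_trans ll'. Qed.

Lemma spans1 a : spans [:: a] a a.
Proof. by exists [::]. Qed.

Lemma spans_sym l a b : spans l a b -> spans l b a.
Proof.
case=> s [p <- sl]; exists (rev (belast a s)); split.
- by rewrite rev_path (eq_path (e' := e)) // => u v; rewrite /= e_sym.
- by case: s {p sl} => //= c s; rewrite rev_cons last_rcons.
- apply: perm_trans sl; rewrite -rev_rcons -lastI.
  by apply/permP => q; rewrite count_rev.
Qed.

Lemma spans_link l1 s l2 a b c d :
  spans l1 a b -> path e b (rcons s c) -> spans l2 c d ->
  spans (l1 ++ s ++ l2) a d.
Proof.
case=> s1 [p1 <- h1] ps [s2 [p2 <- h2]]; exists (s1 ++ rcons s c ++ s2).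
rewrite !cat_path !last_cat p1 last_rcons ps p2; split=> //.
by rewrite cat_rcons; perm_tac.
Qed.

Lemma spans_rcons l a b c : spans l a b -> e b c -> spans (c :: l) a c.
Proof.
move=> ab bc; apply: (@spans_perm (l ++ [::] ++ [:: c])); first by perm_tac.
by apply: spans_link ab _ (spans1 c); rewrite /= bc.
Qed.

Lemma spans_cons l a b c : e c a -> spans l a b -> spans (c :: l) c b.
Proof. by move=> ca /spans_sym ab; apply/spans_sym/(spans_rcons ab); rewrite e_sym. Qed.

Lemma spans_id l a : uniq l -> spans l a a -> l = [:: a].
Proof.
move=> ul [[|b s] [_ ls pl]]; first by rewrite perm_sym in pl; exact: perm_small_eq pl.
by move: ul; rewrite -(perm_uniq pl) cons_uniq -[X in X \notin _]ls [last _ _]/= mem_last.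
Qed.

Lemma spans_mem l a b : spans l a b -> (a \in l) && (b \in l).
Proof. by case=> s [_ <- /perm_mem pl]; rewrite -!pl mem_head mem_last. Qed.

Definition splits (D : seq T) (a b c d : T) :=
  exists l1 l2, [/\ perm_eq (l1 ++ l2) D, spans l1 a b & spans l2 c d].

Lemma splits_swap D a b c d : splits D a b c d -> splits D c d a b.
Proof. by case=> l1 [l2 [pD h1 h2]]; exists l2, l1; split=> //; perm_tac. Qed.

Lemma splits_rev D a b c d : splits D a b c d -> splits D a b d c.
Proof. by case=> l1 [l2 [pD h1 h2]]; exists l1, l2; split=> //; exact: spans_sym. Qed.

Lemma splits_add D a b c d w : splits D a b c d -> e d w -> splits (w :: D) a b c w.
Proof.
case=> l1 [l2 [pD h1 h2]] dw; exists l1, (w :: l2); split=> //; first by perm_tac.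
exact: spans_rcons h2 dw.
Qed.

Lemma splits_addl D a b c d w : splits D a b c d -> e b w -> splits (w :: D) a w c d.
Proof. by move/splits_swap=> h bw; apply/splits_swap/(splits_add h bw). Qed.

Lemma spans_splits D c d w : spans D c d -> splits (w :: D) w w c d.
Proof. by move=> h; exists [:: w], D; split=> //; exact: spans1. Qed.

(* For every [t] at least two of the three ways of matching
   [t] and the ports by two disjoint paths that span [D] together are available,
   unless [t] is itself a port.  The ports may coincide: a single vertex is a hub. *)
Record hub (D : seq T) (x y z : T) : Prop := Hub {
  hub_xy : spans D x y;
  hub_xz : spans D x z;
  hub_yz : spans D y z;
  hub_zx : forall t, t \in D -> t != y -> splits D t z x y \/ splits D t x y z;
  hub_zy : forall t, t \in D -> t != x -> splits D t z x y \/ splits D t y x z;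
  hub_nz : forall t, t \in D -> t != z -> splits D t x y z \/ splits D t y x z }.

Lemma hub1 z : hub [:: z] z z z.
Proof. by split; try exact: spans1; move=> t; rewrite inE => /eqP-> /eqP. Qed.

Lemma hub_flip D x y z : hub D x y z -> hub D y x z.
Proof.
case=> xy xz yz h1 h2 h3; split=> //; first exact: spans_sym.
- by move=> t tD /(h2 t tD)[/splits_rev|]; [left|right].
- by move=> t tD /(h1 t tD)[/splits_rev|]; [left|right].
- by move=> t tD /(h3 t tD)[]; [right|left].
Qed.

(** The new port [w] replaces [y]. A spanning path from [x] to [z] passes through [w] between its
    neighbours [y] and [t0], joining the two paths of a split at [t0]. *)
Lemma hub_add D x y z w t0 :
  hub D x y z -> e y w -> t0 \in D -> t0 != y -> e t0 w -> hub (w :: D) x w z.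
Proof.
case=> xy xz yz h1 h2 h3 yw t0D t0y t0w.
have wy : e w y by rewrite e_sym.
have wt0 : e w t0 by rewrite e_sym.
split.
- exact: spans_rcons xy yw.
- case: (h1 t0 t0D t0y) => -[l1 [l2 [pD k1 k2]]].
    apply: (@spans_perm (l2 ++ [:: w] ++ l1)); first by perm_tac.
    by apply: spans_link k2 _ k1; rewrite /= yw wt0.
  apply: (@spans_perm (l1 ++ [:: w] ++ l2)); first by perm_tac.
  by apply: spans_link (spans_sym k1) _ k2; rewrite /= t0w wy.
- exact: spans_cons wy yz.
- move=> t; rewrite inE => /predU1P[->/eqP//|tD _].
  have [->|ty] := eqVneq t y; last first.
    case: (h1 t tD ty) => h; [left|right]; first exact: splits_add h yw.
    by apply/splits_rev/(splits_add (splits_rev h) yw).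
  (* The old hub promises nothing here at [t = y], so the split at [t0] is used, with [w] put in
     front of [t0]. *)
  case: (h1 t0 t0D t0y) => h.
    right; case: h => l1 [l2 [pD k1 k2]]; exists l2, (w :: l1).
    split; [by perm_tac|exact: spans_sym|exact: spans_cons wt0 k1].
  left; case: h => l1 [l2 [pD k1 k2]]; exists l2, (w :: l1); split=> //.
    by perm_tac.
  by apply: spans_sym; apply: spans_cons wt0 k1.
- move=> t; rewrite inE => /predU1P[-> _|tD tx].
    by right; exact: spans_splits.
  case: (h2 t tD tx) => h; [left|right]; first exact: splits_add h yw.
  exact: splits_addl h yw.
- move=> t; rewrite inE => /predU1P[-> _|tD tz].
    by right; exact: spans_splits.
  case: (h3 t tD tz) => h; [left|right]; last exact: splits_addl h yw.
  by apply/splits_rev/(splits_add (splits_rev h) yw).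
Qed.

Lemma hub_add2 D x y z v w :
  hub D x y z -> e x v -> e y w -> e v w -> hub (v :: w :: D) v w z.
Proof.
case=> xy xz yz h1 h2 h3 xv yw vw.
have vx : e v x by rewrite e_sym.
have wy : e w y by rewrite e_sym.
have wv : e w v by rewrite e_sym.
have vwC l : perm_eq (w :: v :: l) (v :: w :: l) by perm_tac.
have vwS : spans [:: v; w] v w by exists [:: w]; rewrite /= vw.
have ext t : splits D t z x y -> splits (v :: w :: D) t z v w.
  by move=> h; apply/splits_rev/(splits_add (d := x) _ xv)/splits_rev/(splits_add h yw).
have extx t : splits D t x y z -> splits (v :: w :: D) t v w z.
  move=> h; apply: (splits_addl (b := x)) xv.
  by apply/splits_rev/(splits_add (d := y) _ yw)/splits_rev.
have exty t : splits D t y x z -> splits (v :: w :: D) t w v z.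
  move=> h; apply/splits_rev/(splits_add (d := x) _ xv)/splits_rev.
  exact: splits_addl h yw.
have vv : splits (v :: w :: D) v v w z.
  by apply: spans_splits; exact: spans_cons wy yz.
have ww : splits (v :: w :: D) w w v z.
  case: (spans_splits w (spans_cons vx xz)) => l1 [l2 [pD k1 k2]].
  by exists l1, l2; split=> //; perm_tac.
(* Serves the old ports [y] and [x], where the matching field of the old hub is silent: one path
   spans [D] and the other is the pair [v], [w] alone. *)
have old t : spans D t z -> splits (v :: w :: D) t z v w.
  by move=> h; exists D, [:: v; w]; split=> //; perm_tac.
split.
- by apply: (spans_cons vx); exact: spans_rcons xy yw.
- by apply: (spans_cons vw); exact: spans_cons wy yz.
- by apply: (spans_perm (vwC D)); apply: (spans_cons wv); exact: spans_cons vx xz.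
- move=> t; rewrite !inE => /or3P[/eqP-> _|/eqP-> /eqP//|tD _]; first by right.
  have [->|ty] := eqVneq t y; first by left; exact: old.
  by case: (h1 t tD ty) => h; [left; exact: ext|right; exact: extx].
- move=> t; rewrite !inE => /or3P[/eqP-> /eqP//|/eqP-> _|tD _]; first by right.
  have [->|tx] := eqVneq t x; first by left; exact: old.
  by case: (h2 t tD tx) => h; [left; exact: ext|right; exact: exty].
- move=> t; rewrite !inE => /or3P[/eqP-> _|/eqP-> _|tD tz]; [by left|by right|].
  by case: (h3 t tD tz) => h; [left; exact: extx|right; exact: exty].
Qed.

End SpanningPaths.

(** * Induced claws and nets in graphs with three leaves *)

Section InducedSubgraphs.

Variable G : sgraph.
Implicit Types (W S : {set G}) (a b c u v x y z : G).

Let sym : symmetric (@adj G) := @adj_sym G.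
Let irr : irreflexive (@adj G) := @adj_irr G.

Lemma connect_adj_inS W W' a b :
  W \subset W' -> connect (adj_in W) a b -> connect (adj_in W') a b.
Proof.
move=> sWW'; apply: connect_sub => u v /and3P[uW vW uv].
by apply: connect1; rewrite /adj_in /= !(subsetP sWW') ?uv.
Qed.

Lemma connect_adj_in_sym W : connect_sym (adj_in W).
Proof. by apply: sym_connect_sym => u v; rewrite /adj_in /= sym andbCA. Qed.

Lemma connect_adj_in1 W a b :
  a \in W -> b \in W -> adj a b -> connect (adj_in W) a b.
Proof. by move=> aW bW ab; apply: connect1; rewrite /adj_in /= aW bW. Qed.

Lemma last_exit W S a c :
  connect (adj_in W) a c -> a \in S -> c \notin S ->
  exists k b, [/\ k \in S :&: W, b \in W :\: S, adj k b &
               connect (adj_in (W :\: S)) b c].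
Proof.
move=> /connectP[p pp cE] aS cS.
(* The induction needs a second alternative, for tails of the path that already avoid [S]. *)
have: (exists k b, [/\ k \in S :&: W, b \in W :\: S, adj k b &
    connect (adj_in (W :\: S)) b c]) \/ (a \notin S) && connect (adj_in (W :\: S)) a c;
  last by case=> // /andP[]; rewrite aS.
elim: p a {aS} pp cE => [|b p IH] d /=.
  by move=> _ cd; right; rewrite -cd cS connect0.
case/andP=> /and3P[dW bW db] pp cE.
case: (IH b pp cE) => [|/andP[bS bc]]; first by left.
have [dS|dS] := boolP (d \in S).
  by left; exists d, b; rewrite !inE dS dW bS bW.
right; apply: connect_trans bc.
by apply: connect_adj_in1; rewrite ?inE ?dS ?bS.
Qed.

Definition embeds (H : sgraph) W :=
  exists f : H -> G,
    [/\ injective f, forall s t, adj (f s) (f t) = adj s t & forall s, f s \in W].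

Lemma embedsS (H : sgraph) W W' : W \subset W' -> embeds H W -> embeds H W'.
Proof. by move=> /subsetP sW [f [fi fa fW]]; exists f; split=> // x; exact: sW. Qed.

Lemma embeds_claw W c a0 a1 a2 :
  {subset [:: c; a0; a1; a2] <= W} -> adj c a0 -> adj c a1 -> adj c a2 ->
  a0 != a1 -> a0 != a2 -> a1 != a2 ->
  ~~ adj a0 a1 -> ~~ adj a0 a2 -> ~~ adj a1 a2 -> embeds claw W.
Proof.
move=> sW c0 c1 c2 n01 n02 n12 h01 h02 h12.
pose f (o : claw) := if o is Some i then nth a0 [:: a0; a1; a2] i else c.
have cn a : adj c a -> c <> a by move=> + ca; rewrite ca irr.
exists f; split.
- move=> [[[|[|[|?]]] ?]|] [[[|[|[|?]]] ?]|] //= E;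
    try (by congr Some; apply: val_inj);
    try (by case: (cn _ c0 E)); try (by case: (cn _ c1 E));
    try (by case: (cn _ c2 E));
    try (by case: (cn _ c0 (esym E))); try (by case: (cn _ c1 (esym E)));
    try (by case: (cn _ c2 (esym E)));
    by move: n01 n02 n12; rewrite E eqxx ?andbF.
- by move=> [[[|[|[|?]]] ?]|] [[[|[|[|?]]] ?]|] //=;
    rewrite ?irr //; first [apply/negbTE|apply/idP]; rewrite // sym.
- by move=> [[[|[|[|?]]] ?]|] //=; apply: sW; rewrite !inE eqxx ?orbT.
Qed.

(** Makes any map from the net that preserves adjacency and non-adjacency injective. *)
Lemma net_twin_free (s t : net) : (forall w : net, adj s w = adj t w) -> s = t.
Proof.
case: s t => c i [d j] h; have := h (~~ c, i); have := h (true, j).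
rewrite /= /net_adj /= !eqxx eq_sym; have [->|] := eqVneq i j.
  by case: c d {h} => [] [].
by case: c {h} => //=; case: d; rewrite ?andbF.
Qed.

Lemma embeds_net W a0 a1 a2 b0 b1 b2 :
  {subset [:: a0; a1; a2; b0; b1; b2] <= W} ->
  [/\ adj a0 a1, adj a0 a2 & adj a1 a2] -> [/\ adj a0 b0, adj a1 b1 & adj a2 b2] ->
  [/\ ~~ adj a0 b1, ~~ adj a0 b2 & ~~ adj a1 b0] ->
  [/\ ~~ adj a1 b2, ~~ adj a2 b0 & ~~ adj a2 b1] ->
  [/\ ~~ adj b0 b1, ~~ adj b0 b2 & ~~ adj b1 b2] -> embeds net W.
Proof.
move=> sW [h1 h2 h3] [h4 h5 h6] [h7 h8 h9] [h10 h11 h12] [h13 h14 h15].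
pose f (s : net) := nth a0 (if s.1 then [:: b0; b1; b2] else [:: a0; a1; a2]) s.2.
have fa s t : adj (f s) (f t) = adj s t.
  by case: s t => [[] [[|[|[|?]]] ?]] [[] [[|[|[|?]]] ?]] //=;
    rewrite /net_adj /= -?val_eqE /= ?irr //; first [apply/negbTE|apply/idP];
    rewrite // sym.
exists f; split=> //.
- by move=> s t st; apply: net_twin_free => w; rewrite -!fa st.
- by case=> [[] [[|[|[|?]]] ?]] //=; apply: sW; rewrite !inE eqxx ?orbT.
Qed.

Definition leaf W x := {in W &, forall a b, adj x a -> adj x b -> a = b}.

(* If one of the two branches at the neighbour [x] of [X] can be bypassed, then
   [x] is a leaf of a smaller set that still reaches [Y] and [Z]. *)
Lemma claw_or_net_of_three_leaves W X Y Z :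
  X \in W -> Y \in W -> Z \in W -> X != Y -> X != Z -> Y != Z ->
  leaf W X -> leaf W Y -> leaf W Z ->
  connect (adj_in W) X Y -> connect (adj_in W) X Z ->
  embeds claw W \/ embeds net W.
Proof.
have [n] := ubnP #|W|; elim: n W X Y Z => // n IH W X Y Z Wn XW YW ZW XY XZ YZ lX lY lZ cY cZ.
have [x xW Xx] : exists2 x, x \in W & adj X x.
  move/connectP: cY => [[|x p] /= + E]; first by rewrite E eqxx in XY.
  by case/andP=> /and3P[_ xW Xx] _; exists x.
have xX : adj x X by rewrite sym.
have xneX : x != X by apply/eqP=> E; rewrite E irr in Xx.
have Xonly v : v \in W -> adj X v -> v = x by move=> vW Xv; exact: lX Xv Xx.
(* If [x] were [U], then [X] and [U] would be adjacent leaves, cut off together from [V]. *)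
have xne U V : U \in W -> leaf W U -> U != V -> X != U -> X != V -> V \in W ->
    connect (adj_in W) X V -> x != U.
  move=> UW lU UV XU XV VW cV; apply/eqP=> xU.
  case: (last_exit (S := [set X; U]) cV); rewrite ?inE ?eqxx //.
    by rewrite negb_or eq_sym XV eq_sym UV.
  move=> k [b []]; rewrite !inE negb_or => /andP[/orP[]/eqP-> _] /andP[/andP[bX bU] bW] kb _.
    by rewrite -xU (Xonly b) ?eqxx in bU.
  by case/eqP: bX; apply: lU kb _; rewrite // -xU.
have xY : x != Y by exact: xne cZ.
have xZ : x != Z by apply: xne cY; rewrite // eq_sym.
pose N := x |: [set v | adj x v].
have XN : X \in N by rewrite !inE xX orbT.
(* On a path from [X] to [V], [k] is the last vertex in the closed neighbourhood [N] of [x], and [b]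
   is its successor. *)
have exit V : V \in W -> leaf W V -> x != V -> connect (adj_in W) X V -> ~~ adj x V ->
    exists k b, [/\ k \in W, b \in W, adj x k & adj k b] /\
      [/\ k != X, b != x, ~~ adj x b & connect (adj_in (W :\: N)) b V].
  move=> VW lV xV cV xVn; case: (last_exit cV XN); first by rewrite !inE eq_sym negb_or xV.
  move=> k [b []]; rewrite !inE negb_or => /andP[kN kW] /andP[/andP[bx xb] bW] kb cb.
  have kx : adj x k by case/predU1P: kN => // kx; rewrite kx (negbTE xb) in kb.
  exists k, b; split=> //; split=> //; apply/eqP=> kX.
  by rewrite kX in kb; rewrite (Xonly b bW kb) eqxx in bx.
(* A leaf [U] adjacent to [x] gives a claw with centre [x], whose other two leaves are [X] and any
   further neighbour [k] of [x]. *)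
have clawY U k : U \in W -> leaf W U -> X != U -> adj x U -> k \in W -> k != X ->
    k != U -> adj x k -> embeds claw W.
  move=> UW lU XU xU kW kX kU xk.
  apply: (@embeds_claw W x X U k) => //.
  - by move=> v; rewrite !inE => /or4P[] /eqP->.
  - by rewrite eq_sym.
  - by rewrite eq_sym.
  - by apply/negP => /(Xonly U UW) E; rewrite E irr in xU.
  - by apply/negP => /(Xonly k kW) E; rewrite E irr in xk.
  - apply/negP => Uk; have E : x = k by apply: lU; rewrite // sym.
    by rewrite E irr in xk.
have [xYa|xYn] := boolP (adj x Y).
  left; have [xZa|xZn] := boolP (adj x Z).
    by apply: (clawY Y Z) => //; rewrite eq_sym.
  have [k [b [[kW bW xk kb] [kX bx xb _]]]] := exit Z ZW lZ xZ cZ xZn.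
  apply: (clawY Y k) => //; apply/eqP=> kY; rewrite kY in kb.
  by case/eqP: bx; apply: lY => //; rewrite sym.
have [xZa|xZn] := boolP (adj x Z).
  left; have [k [b [[kW bW xk kb] [kX bx xb _]]]] := exit Y YW lY xY cY xYn.
  apply: (clawY Z k) => //; apply/eqP=> kZ; rewrite kZ in kb.
  by case/eqP: bx; apply: lZ => //; rewrite sym.
have [k [b [[kW bW xk kb] [kX bx xb cb]]]] := exit Y YW lY xY cY xYn.
have [k' [b' [[kW' bW' xk' kb'] [kX' bx' xb' cb']]]] := exit Z ZW lZ xZ cZ xZn.
(* Of the neighbours of [x] only [j] is kept, so [x] becomes a leaf and takes over the role of [X],
   which is dropped. *)
pose W' j := x |: (j |: W :\: N).
have step j : j \in W -> adj x j -> j != X ->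
    connect (adj_in (W' j)) j Y -> connect (adj_in (W' j)) j Z ->
    embeds claw W \/ embeds net W.
  move=> jW xj jX jY jZ.
  have sub : W' j \subset W.
    by apply/subsetP=> v; rewrite !inE => /or3P[/eqP->|/eqP->|/andP[]].
  have xW' : x \in W' j by rewrite !inE eqxx.
  have jW' : j \in W' j by rewrite !inE eqxx orbT.
  have xjc : connect (adj_in (W' j)) x j by exact: connect_adj_in1.
  case: (IH (W' j) x Y Z); rewrite ?(connect_trans xjc) //.
  - apply: leq_trans (_ : #|W| <= n) => //; apply: proper_card.
    apply/properP; split=> //; exists X => //.
    by rewrite !inE xX orbT /= orbF negb_or eq_sym xneX eq_sym jX.
  - by rewrite !inE (negbTE xYn) orbF eq_sym (negbTE xY) YW /= orbT.
  - by rewrite !inE (negbTE xZn) orbF eq_sym (negbTE xZ) ZW /= orbT.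
  - move=> u v; rewrite !inE => hu hv xu xv.
    have aux w : [|| w == x, w == j | ~~ ((w == x) || adj x w) && (w \in W)] ->
        adj x w -> w = j.
      by case/or3P => [/eqP->|/eqP->//|]; rewrite ?irr // negb_or => /andP[/andP[_ /negP]].
    by rewrite (aux u) // (aux v).
  - by move=> u v /(subsetP sub) uW /(subsetP sub) vW; exact: lY.
  - by move=> u v /(subsetP sub) uW /(subsetP sub) vW; exact: lZ.
  - by move/(embedsS sub); left.
  - by move/(embedsS sub); right.
have toW' j u v : connect (adj_in (W :\: N)) u v -> connect (adj_in (W' j)) u v.
  by apply: connect_adj_inS; apply/subsetP=> w wN; rewrite !inE in wN *; rewrite wN !orbT.
have first_edge j c V : c \in W -> ~~ adj x c -> c != x -> adj j c ->
    connect (adj_in (W :\: N)) c V -> connect (adj_in (W' j)) j V.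
  move=> cW xc cx jc cV; apply: connect_trans (toW' j _ _ cV).
  apply: connect_adj_in1; rewrite // !inE ?eqxx ?orbT //.
  by rewrite negb_or cx xc cW !orbT.
have jY := first_edge k b Y bW xb bx kb cb.
have jZ' := first_edge k' b' Z bW' xb' bx' kb' cb'.
have [kk'|kk'] := eqVneq k k'.
  by apply: (step k) => //; rewrite kk'.
have [akk'|akk'] := boolP (adj k k'); last first.
  left; apply: (@embeds_claw W x X k k') => //.
  - by move=> v; rewrite !inE => /or4P[] /eqP->.
  - by rewrite eq_sym.
  - by rewrite eq_sym.
  - by apply/negP => /(Xonly k kW) E; rewrite E irr in xk.
  - by apply/negP => /(Xonly k' kW') E; rewrite E irr in xk'.
(* Each of the edges [k' b], [k b'] and [b b'] would let one of [k], [k'] reach both [Y] and [Z]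
   outside [N]. Without them, the triangle [x], [k], [k'] with pendants [X], [b], [b'] is a net. *)
have [k'b|k'b] := boolP (adj k' b).
  by apply: (step k') => //; exact: first_edge cb.
have [kb1|kb1] := boolP (adj k b').
  by apply: (step k) => //; exact: first_edge cb'.
have [bb'|bb'] := boolP (adj b b').
  apply: (step k') => //; apply: (first_edge _ b') => //.
  by apply: connect_trans cb; apply: connect_adj_in1;
     rewrite ?inE ?negb_or ?bx ?xb ?bx' ?xb' // sym.
have nX v : v \in W -> v != x -> ~~ adj X v.
  by move=> vW vx; apply/negP => /(Xonly v vW) E; rewrite E eqxx in vx.
have kx : k != x by apply/eqP=> E; rewrite E irr in xk.
have kx' : k' != x by apply/eqP=> E; rewrite E irr in xk'.
right; apply: (@embeds_net W x k k' X b b');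
  first (by apply/allP; rewrite /= xW kW kW' XW bW bW'); split=> //.
- by rewrite sym nX.
- by rewrite sym nX.
- exact: nX.
- exact: nX.
Qed.

End InducedSubgraphs.

(** * From claws and nets to a large degree sum *)

Section HeavyVertices.

Variable G : sgraph.
Implicit Types (W D : {set G}) (u v w x y z : G).

Definition soft u v := adj u v || heavy_pair u v.

Lemma soft_sym : symmetric soft.
Proof.
by move=> u v; rewrite /soft /heavy_pair (adj_sym u v) eq_sym (addnC (degree u)).
Qed.

Lemma adj_soft u v : adj u v -> soft u v.
Proof. by rewrite /soft => ->. Qed.

Lemma degree_soft u v : u != v -> #|G| <= degree u + degree v -> soft u v.
Proof. by rewrite /soft /heavy_pair => -> ->; case: (adj u v). Qed.

Lemma heavy_degreeD u v : heavy u -> heavy v -> #|G| <= degree u + degree v.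
Proof. rewrite /heavy; lia. Qed.

Lemma iso_induced_embedding (S : sgraph) (f : S -> G) :
  injective f -> (forall s t, adj (f s) (f t) = adj s t) ->
  iso_induced (f @: [set: S]) S.
Proof. by move=> fi fa; exists f. Qed.

(** The pendant edge of branch [i] is a maximal clique of the net: no vertex of another branch is
    adjacent to its leaf. Removing it leaves a component with two or more vertices inside the other
    branches. Two uses give heavy vertices in different branches. *)
Lemma c_heavy_net_heavy (f : net -> G) i :
  c_heavy net G -> injective f -> (forall s t, adj (f s) (f t) = adj s t) ->
  exists2 s : net, s.2 != i & heavy (f s).
Proof.
move=> hnet fi fa; set X := f @: [set: net].
pose C := [set f (false, i); f (true, i)].
have maxC : maximal_clique X C.
  apply/maxsetP; split=> [|B /andP[/subsetP sBX /forall_inP clB] sCB].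
    rewrite /= subUset !sub1set !imset_f ?inE //=.
    apply/forall_inP => u uC; apply/forall_inP => v vC; apply/implyP.
    by move: uC vC; rewrite !inE => /orP[]/eqP-> /orP[]/eqP->; rewrite ?eqxx // fa /= /net_adj /= eqxx.
  apply/eqP; rewrite eqEsubset sCB andbT; apply/subsetP => u uB.
  case/imsetP: (sBX u uB) => -[c j] _ uE.
  have [ij|ij] := eqVneq j i; first by rewrite uE ij !inE; case: c {uE}; rewrite eqxx ?orbT.
  have iB : f (true, i) \in B by apply: (subsetP sCB); rewrite !inE eqxx orbT.
  move/forall_inP/(_ _ iB): (clB u uB); rewrite uE (inj_eq fi) fa /= /net_adj /= (negbTE ij) andbF.
  by rewrite xpair_eqE (negbTE ij) andbF.
have [j ji] : exists j : 'I_3, j != i.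
  by case: (eqVneq i ord0) => [->|]; [exists ord_max|exists ord0; rewrite eq_sym].
have inXC c : f (c, j) \in X :\: C.
  by rewrite !inE !(inj_eq fi) !xpair_eqE (negbTE ji) !andbF imset_f ?inE.
pose K := [set v | connect (adj_in (X :\: C)) (f (false, j)) v].
have K2 : 1 < #|K|.
  apply/card_gt1P; exists (f (false, j)), (f (true, j)).
  split; rewrite ?inE ?connect0 ?(inj_eq fi) //.
  by apply: connect_adj_in1; rewrite ?inXC // fa /= /net_adj /= eqxx.
have compK : component (X :\: C) K by exists (f (false, j)).
have [v vK hv] := hnet X (iso_induced_embedding fi fa) C maxC K compK K2.
have : v \in X :\: C.
  rewrite inE in vK; case/connectP: vK => p; case/lastP: p => [|p w] /=.
    by move=> _ ->.
  by rewrite rcons_path last_rcons => /andP[_ /and3P[_ ? _]] ->.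
rewrite inE => /andP[vC /imsetP[s _ vE]]; exists s; last by rewrite -vE.
apply: contraNneq vC; case: s vE => c k -> /= ->.
by rewrite !inE; case: c; rewrite eqxx ?orbT.
Qed.

Lemma degree_sum_of_three_terminals D x y z X Y Z :
  claw_o_heavy G -> c_heavy net G ->
  x \in D -> y \in D -> z \in D ->
  connect (adj_in D) x y -> connect (adj_in D) x z ->
  adj x X -> adj y Y -> adj z Z -> X \notin D -> Y \notin D -> Z \notin D ->
  X != Y -> X != Z -> Y != Z -> ~~ soft X Y -> ~~ soft X Z -> ~~ soft Y Z ->
  {in D, forall t, soft X t -> t = x} -> {in D, forall t, soft Y t -> t = y} ->
  {in D, forall t, soft Z t -> t = z} ->
  exists g h, [/\ g \in D, h \in D, g != h & #|G| <= degree g + degree h].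
Proof.
move=> hclaw hnet xD yD zD cxy cxz xX yY zZ XD YD ZD XY XZ YZ sXY sXZ sYZ uX uY uZ.
pose T := [set X; Y; Z].
have TT s t : s \in T -> t \in T -> s != t -> ~~ soft s t.
  rewrite !inE -!orbA => /or3P[]/eqP-> /or3P[]/eqP->; rewrite ?eqxx //.
  - by rewrite soft_sym.
  - by rewrite soft_sym.
  - by rewrite soft_sym.
(* The only possible soft neighbour of a terminal in [D] is its actual neighbour, so this soft pair
   is an edge. *)
have TD s t : s \in T -> t \in D -> soft s t -> adj s t.
  by rewrite !inE -!orbA => /or3P[]/eqP-> tD; [move/uX->|move/uY->|move/uZ->];
    rewrite // adj_sym.
have TU s t t' : s \in T -> t \in D -> t' \in D -> soft s t -> soft s t' -> t = t'.
  rewrite !inE -!orbA => /or3P[]/eqP-> tD tD'.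
  - by move/uX=> -> // /uX ->.
  - by move/uY=> -> // /uY ->.
  - by move/uZ=> -> // /uZ ->.
pose W := D :|: T.
have inW v : v \in W = (v \in D) || (v \in T) by rewrite inE.
have WD s v : s \in T -> v \in W -> adj s v -> v \in D.
  move=> sT; rewrite inW => /orP[//|vT sv].
  have [E|ne] := eqVneq s v; first by rewrite E adj_irr in sv.
  by have := TT s v sT vT ne; rewrite (adj_soft sv).
have leafT s : s \in T -> leaf W s.
  move=> sT a b aW bW sa sb.
  by apply: (TU s) => //; rewrite ?adj_soft //; apply: (WD s).
have sDW : D \subset W by exact: subsetUl.
have [XT YT ZT] : [/\ X \in T, Y \in T & Z \in T] by rewrite !inE !eqxx ?orbT.
have TW s : s \in T -> s \in W by rewrite inW orbC => ->.
have cX v : v \in D -> connect (adj_in D) x v -> connect (adj_in W) X v.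
  move=> vD xv; apply: connect_trans (connect_adj_inS sDW xv).
  by apply: connect_adj_in1; [exact: TW|exact: (subsetP sDW)|rewrite adj_sym].
have ext v V : v \in D -> V \in T -> adj v V -> connect (adj_in W) X v -> connect (adj_in W) X V.
  move=> vD VT vV Xv; apply: connect_trans Xv _.
  by apply: connect_adj_in1; [exact: (subsetP sDW)|exact: TW|].
have [] := @claw_or_net_of_three_leaves G W X Y Z; rewrite ?TW //; try exact: leafT.
- exact: ext yY (cX y yD cxy).
- exact: ext zZ (cX z zD cxz).
- case=> f [fi fa fW].
  have [u [v [/imsetP[s _ uE] /imsetP[t _ vE] hp]]] := hclaw _ (iso_induced_embedding fi fa).
  have hs : soft u v by rewrite /soft hp orbT.
  case/and3P: hp => uv nuv duv; exists u, v.
  have uW : u \in W by rewrite uE.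
  have vW : v \in W by rewrite vE.
  have [uT|uT] := boolP (u \in T).
    have vD : v \in D.
      by move: vW; rewrite inW => /orP[//|vT]; rewrite (negbTE (TT u v uT vT uv)) in hs.
    by rewrite (TD u v uT vD hs) in nuv.
  have uD : u \in D by move: uW; rewrite inW (negbTE uT) orbF.
  split=> //; move: vW; rewrite inW => /orP[//|vT].
  by rewrite adj_sym (TD v u vT uD) // soft_sym in nuv.
- case=> f [fi fa fW].
  have [s _ hs] := c_heavy_net_heavy ord0 hnet fi fa.
  have [t ts ht] := c_heavy_net_heavy s.2 hnet fi fa.
  have fne : f s != f t by rewrite (inj_eq fi); apply: contraNneq ts => ->.
  have deg := heavy_degreeD hs ht.
  (* A terminal [f a] soft to a vertex of another branch is adjacent to it, hence is a triangle
     vertex. Its own pendant leaf is then a second neighbour in [D], which a terminal cannot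
     have. *)
  have main a b : f a \in T -> a.2 != b.2 -> soft (f a) (f b) -> False.
    move=> aT ab sab; have fab : f a != f b by rewrite (inj_eq fi); apply: contraNneq ab => ->.
    have bD : f b \in D.
      by move: (fW b); rewrite inW => /orP[//|bT]; rewrite (negbTE (TT _ _ aT bT fab)) in sab.
    have := TD _ _ aT bD sab; rewrite fa; case: a aT ab sab fab => c i aT ab sab _.
    rewrite /= /net_adj /= (negbTE ab) => /andP[ci _]; rewrite (negbTE ci) in aT sab.
    have il : adj (f (false, i)) (f (true, i)) by rewrite fa /= /net_adj /= eqxx.
    have E := TU _ _ _ aT bD (WD _ _ aT (fW _) il) sab (adj_soft il).
    by rewrite (fi _ _ E) eqxx in ab.
  have sst := degree_soft fne deg.
  exists (f s), (f t); split=> //.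
    by move: (fW s); rewrite inW => /orP[//|sT]; case: (main s t); rewrite // eq_sym.
  by move: (fW t); rewrite inW => /orP[//|tT]; case: (main t s); rewrite // soft_sym.
Qed.

End HeavyVertices.

(** * Bondy-Chvatal closure: replacing heavy pairs on a cycle by edges *)

Lemma split_or_count (T : eqType) (P Q : pred T) a s :
  (exists s1 v s2, [/\ s = s1 ++ v :: s2, Q v & P (last a s1)]) \/
  count Q s + count P (belast a s) <= size s.
Proof.
elim: s a => [|b s IH] a /=; first by right.
have [[s1 [v [s2 [-> Qv Pl]]]]|IHb] := IH b; first by left; exists (b :: s1), v, s2.
have [/andP[Qb Pa]|nQP] := boolP (Q b && P a); first by left; exists [::], b, s.
by right; move: IHb nQP; case: (Q b); case: (P a) => //=; lia.
Qed.

Section SoftCycles.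

Variable G : sgraph.

Lemma degree_count (v : G) : degree v = count (adj v) (enum G).
Proof. by rewrite enumT /degree cardsE cardE /enum_mem size_filter. Qed.

Lemma ore_step (r : rel G) a s :
  symmetric r -> subrel (@adj G) r -> path r a s -> uniq (a :: s) ->
  heavy_pair a (last a s) ->
  exists2 c, ucycle r c & {subset a :: s <= c}.
Proof.
move=> r_sym adj_r pas uas /and3P[_ _ deg]; set b := last a s in deg.
have [/existsP[w /and3P[wc aw bw]]|nw] :=
    boolP [exists w, [&& w \notin a :: s, adj a w & adj b w]].
  exists (w :: a :: s); last by move=> v vc; rewrite inE vc orbT.
  by rewrite /ucycle cons_uniq wc uas /= rcons_path pas r_sym !adj_r.
(* Ore's crossover: if a neighbour of [b] is followed on the path by a neighbour [v] of [a],
   reversing the tail from [v] on closes a cycle that avoids the pair [a], [b]. *)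
have [[s1 [v [s2 [sE av bv]]]]|cnt] := split_or_count (adj b) (adj a) a s.
  have pE : perm_eq (a :: s) (a :: s1 ++ rev (v :: s2)) by rewrite sE; perm_tac.
  exists (a :: s1 ++ rev (v :: s2)); last by move=> w; rewrite (perm_mem pE).
  rewrite /ucycle -(perm_uniq pE) uas andbT /= rcons_cat cat_path.
  move: pas bv; rewrite /b sE last_cat cat_path /= => /and3P[-> _ pv] bv /=.
  by apply: (rev_path_rcons r_sym); rewrite /= rcons_path pv !adj_r.
(* Now the two degrees sum to at most [size s] on the path plus [size o] off it, which is one less
   than [#|G|]. *)
exfalso; pose o := [seq v <- enum G | v \notin a :: s].
have pE : perm_eq (a :: s ++ o) (enum G).
  apply: uniq_perm; rewrite ?enum_uniq //.
    rewrite -cat_cons cat_uniq uas filter_uniq ?enum_uniq // andbT.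
    by apply/hasPn => v; rewrite mem_filter => /andP[].
  by move=> v; rewrite -cat_cons mem_cat mem_filter !mem_enum !inE andbT orbN.
have dE v : degree v = count (adj v) (a :: s) + count (adj v) o.
  by rewrite degree_count -(permP pE) -cat_cons count_cat.
have co : count (adj a) o + count (adj b) o <= size o.
  rewrite -count_predUI [count (predI _ _) _](_ : _ = 0) ?addn0 ?count_size //.
  apply/eqP; rewrite -leqn0 leqNgt -has_count; apply/hasPn => v.
  rewrite mem_filter => /andP[vo _]; apply: contra nw => /andP[av bv].
  by apply/existsP; exists v; rewrite vo av.
have cb : count (adj b) (a :: s) = count (adj b) (belast a s).
  by rewrite lastI -cats1 count_cat /= adj_irr addn0 addn0.
have := perm_size pE; rewrite /= size_cat -cardE => sz.
move: deg; rewrite !dE cb /= adj_irr add0n -sz addnACA => deg.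
by have := leq_trans deg (leq_add cnt co); rewrite ltnn.
Qed.

(** [F] holds the heavy pairs still allowed as edges. They are given up one unordered pair at a
    time, by [ore_step] whenever the cycle uses the pair. *)
Lemma remove_heavy_pairs (F : {set G * G}) c :
  (forall u v, (u, v) \in F -> heavy_pair u v /\ (v, u) \in F) ->
  ucycle [rel u v | adj u v || ((u, v) \in F)] c -> 2 < size c ->
  exists2 c', ucycle (@adj G) c' & {subset c <= c'}.
Proof.
have [n] := ubnP #|F|; elim: n F c => // n IH F c Fn hF cyc c3.
have [F0|[[u v] uvF]] := set_0Vmem F.
  exists c => //; move: cyc; rewrite F0 /ucycle; congr (_ && _).
  by apply: eq_cycle => a b; rewrite /= inE orbF.
case/andP: cyc => cyc uc; have [hp vuF] := hF u v uvF; have neuv : u != v by case/and3P: hp.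
pose F' := F :\ (u, v) :\ (v, u).
have hF' a b : (a, b) \in F' -> heavy_pair a b /\ (b, a) \in F'.
  rewrite !in_setD1 !xpair_eqE => /and3P[n1 n2 /hF[-> ->]].
  by rewrite (andbC (b == v)) n2 (andbC (b == u)) n1.
have F'n : #|F'| < n.
  rewrite -ltnS; apply: leq_trans Fn; rewrite ltnS; apply: proper_card.
  apply/properP; split; first by apply/subsetP=> p; rewrite !inE => /and3P[].
  by exists (v, u); rewrite // !inE eqxx.
pose r := [rel a b | adj a b || ((a, b) \in F)].
pose r' := [rel a b : G | adj a b || ((a, b) \in F')].
have r'_sym : symmetric r'.
  move=> a b /=; rewrite adj_sym; congr (_ || _).
  by apply/idP/idP => /hF'[].
have rr' : {in predC1 u &, subrel r r'}.
  move=> a b; rewrite !inE => au bu /= /orP[->//|abF].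
  by rewrite !inE !xpair_eqE (negbTE au) (negbTE bu) andbF abF orbT.
have fin c' : ucycle r' c' -> {subset c <= c'} ->
    exists2 c'', ucycle (@adj G) c'' & {subset c <= c''}.
  move=> cyc' sub; have [c'' ? sub'] := IH F' c' F'n hF' cyc' (leq_trans c3 (uniq_leq_size uc sub)).
  by exists c'' => // w /sub /sub'.
have [uinc|uninc] := boolP (u \in c); last first.
  apply: (fin c) => //; rewrite /ucycle uc andbT.
  apply: (sub_in_cycle rr') cyc; apply/allP => w wc; rewrite !inE.
  by apply: contraNneq uninc => <-.
(* On a cycle that starts at [u], the removed pair can only be the first or the closing step. *)
have [i s cE] := rot_to uinc.
have subc c' : {subset u :: s <= c'} -> {subset c <= c'}.
  by move=> sub w wc; apply: sub; rewrite -cE mem_rot.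
have us : uniq (u :: s) by rewrite -cE rot_uniq.
move: cyc; rewrite -(rot_cycle i) cE => cyc.
have : 1 < size s by have := size_rot i c; rewrite cE => sE; rewrite -sE in c3.
case: s cE subc us cyc => [//|w s] cE subc us + s1.
rewrite /= rcons_path => /and3P[ruw pws rlu].
have pws' : path r' w s.
  apply: (sub_in_path rr') pws; apply/allP => t ts; rewrite !inE.
  by apply: contraNneq (proj1 (andP us)) => <-.
have unF a : (r u a -> ~~ r' u a -> a = v) /\ (r a u -> ~~ r' a u -> a = v).
  by split=> /= h nr; apply/eqP; apply: contraNT nr => av;
    case/orP: h => [->//|aF];
    rewrite !inE !xpair_eqE (negbTE av) (negbTE neuv) ?andbF /= aF orbT.
have adjr' : subrel (@adj G) r' by move=> a b /= ->.
have [ruw'|ruw'] := boolP (r' u w).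
  have [rlu'|rlu'] := boolP (r' (last w s) u).
    apply: (fin (u :: w :: s)); last exact: subc.
    by rewrite /ucycle us andbT /= rcons_path; apply/and3P.
  have lv := (unF _).2 rlu rlu'.
  have [|||c' cyc' sub] := @ore_step r' u (w :: s) r'_sym adjr'.
  - by apply/andP.
  - by [].
  - by rewrite /= lv.
  by apply: (fin c') => //; exact: subc.
have wv := (unF _).1 ruw ruw'.
(* Both steps cannot be the removed pair: [w] and the last vertex would both be [v], but the cycle
   has more than two vertices. *)
have [rlu'|rlu'] := boolP (r' (last w s) u); last first.
  have lv := (unF _).2 rlu rlu'.
  case: s us lv s1 {cE subc ruw rlu ruw' rlu' pws pws'} => [//|t s] /= us lv _.
  by move: us; rewrite wv -lv mem_last andbF.
have [|||c' cyc' sub] := @ore_step r' w (rcons s u) r'_sym adjr'.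
- by rewrite rcons_path pws'.
- by move: us; rewrite -rcons_cons rcons_uniq.
- by rewrite last_rcons wv; case: (hF v u vuF).
apply: (fin c') => //; apply: subc => t; rewrite inE => tus; apply: sub.
by rewrite -rcons_cons mem_rcons inE.
Qed.

Lemma soft_cycle_extend (c : seq G) :
  ucycle (@soft G) c -> 2 < size c ->
  exists2 c', ucycle (@adj G) c' & {subset c <= c'}.
Proof.
move=> cyc c3; apply: (@remove_heavy_pairs [set p | heavy_pair p.1 p.2]) => //.
  move=> u v; rewrite !inE /= => h; split=> //; move: h.
  by rewrite /heavy_pair adj_sym eq_sym addnC.
move: cyc; rewrite /ucycle; congr (_ && _); apply: eq_cycle => u v /=.
by rewrite inE.
Qed.

End SoftCycles.

(** * Two hubs joined by three paths *)

Section Configurations.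

Variables (G : sgraph) (M : nat).
Hypothesis M_gt2 : 2 < M.
Hypothesis M_max : forall c, ucycle (@soft G) c -> 2 < size c -> size c <= M.
Hypothesis hclaw : claw_o_heavy G.
Hypothesis hnet : c_heavy net G.

Implicit Types (D s p : seq G) (x y z a b g h : G).

Local Notation spans := (spans (@soft G)).
Local Notation splits := (splits (@soft G)).
Local Notation hub := (hub (@soft G)).
Let ssym : symmetric (@soft G) := @soft_sym G.

Lemma spans_closed_size l a b s :
  spans l a b -> path (@soft G) b (rcons s a) -> uniq (l ++ s) ->
  2 < size (l ++ s) -> size (l ++ s) <= M.
Proof.
case=> t [pat <- pl] ps ul sz.
have pE : perm_eq (a :: t ++ s) (l ++ s) by perm_tac.
rewrite -(perm_size pE); apply: M_max; last by rewrite (perm_size pE).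
by rewrite /ucycle (perm_uniq pE) ul andbT /= rcons_cat cat_path pat.
Qed.

(* Two disjoint hubs joined by three disjoint paths [s1], [s2] and [p] such that
   the hubs together with [s1] and [s2] already have the size of a longest cycle. *)
Record config D x y z D' x' y' z' s1 s2 p : Prop := Config {
  cf_hub : hub D x y z;
  cf_hub' : hub D' x' y' z';
  cf_conn : connect (adj_in [set v in D]) x y && connect (adj_in [set v in D]) x z;
  cf_conn' :
    connect (adj_in [set v in D']) x' y' && connect (adj_in [set v in D']) x' z';
  cf_s1 : path (@adj G) y (rcons s1 y');
  cf_s2 : path (@adj G) x (rcons s2 x');
  cf_p : path (@adj G) z (rcons p z');
  cf_p0 : 0 < size p;
  cf_uniq : uniq (D ++ D' ++ s1 ++ s2 ++ p);
  cf_size : size (D ++ D' ++ s1 ++ s2) = M }.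

(** Together with [config_flip], this symmetry reduces claims to one hub and to one of the ports
    [x], [y]. *)
Lemma config_swap D x y z D' x' y' z' s1 s2 p :
  config D x y z D' x' y' z' s1 s2 p ->
  config D' x' y' z' D x y z (rev s1) (rev s2) (rev p).
Proof.
case=> hD hD' cD cD' h1 h2 hp p0 u sz; split=> //.
- exact: rev_path_rcons (@adj_sym G) _ _ _ h1.
- exact: rev_path_rcons (@adj_sym G) _ _ _ h2.
- exact: rev_path_rcons (@adj_sym G) _ _ _ hp.
- by rewrite size_rev.
- by move: u; congr (is_true _); apply: perm_uniq; perm_tac.
- by rewrite -sz; apply: perm_size; perm_tac.
Qed.

Lemma config_flip D x y z D' x' y' z' s1 s2 p :
  config D x y z D' x' y' z' s1 s2 p -> config D y x z D' y' x' z' s2 s1 p.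
Proof.
have cflip E a b c : connect (adj_in [set v in E]) a b && connect (adj_in [set v in E]) a c ->
    connect (adj_in [set v in E]) b a && connect (adj_in [set v in E]) b c.
  move=> /andP[ab ac]; have ba : connect (adj_in [set v in E]) b a by rewrite connect_adj_in_sym.
  by rewrite ba (connect_trans ba ac).
case=> hD hD' cD cD' h1 h2 hp p0 u sz; split=> //; try exact: hub_flip; try exact: cflip.
- by move: u; congr (is_true _); apply: perm_uniq; perm_tac.
- by rewrite -sz; apply: perm_size; perm_tac.
Qed.

Lemma config_soft D x y z D' x' y' z' s1 s2 p :
  config D x y z D' x' y' z' s1 s2 p ->
  [/\ path (@soft G) y (rcons s1 y'), path (@soft G) x (rcons s2 x') &
      path (@soft G) z (rcons p z')].
Proof.
by case=> _ _ _ _ h1 h2 hp _ _ _; split; [move: h1|move: h2|move: hp];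
  apply: sub_path; exact: adj_soft.
Qed.

(** The closed path would be a soft cycle with [M + size p1] vertices. Later [p1] is either all of
    [p] or its first vertex. *)
Lemma config_no_span D x y z D' x' y' z' s1 s2 p1 p2 l a b s :
  config D x y z D' x' y' z' s1 s2 (p1 ++ p2) -> 0 < size p1 ->
  spans l a b -> path (@soft G) b (rcons s a) ->
  perm_eq (l ++ s) (D ++ D' ++ s1 ++ s2 ++ p1) -> False.
Proof.
case=> _ _ _ _ _ _ _ _ u sz p10 ab ps pE.
have szE : size (l ++ s) = M + size p1 by rewrite (perm_size pE) -sz !size_cat !addnA.
suff : size (l ++ s) <= M by rewrite szE; lia.
apply: spans_closed_size ab ps _ _; last by rewrite szE; lia.
rewrite (perm_uniq pE); apply: subseq_uniq u.
by do 4! rewrite cat_subseq //; exact: prefix_subseq.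
Qed.

(** If [s1] were empty, the cycle through both hubs along [p] and [s2] would leave nothing out. *)
Lemma config_s1 D x y z D' x' y' z' s1 s2 p :
  config D x y z D' x' y' z' s1 s2 p -> s1 <> [::].
Proof.
move=> cf s10; have [_ e2 ep] := config_soft cf.
have cf0 : config D x y z D' x' y' z' s1 s2 (p ++ [::]) by rewrite cats0.
apply: (config_no_span cf0 (cf_p0 cf) (l := D ++ p ++ D') (s := rev s2)).
- exact: spans_link (hub_xz (cf_hub cf)) ep (spans_sym ssym (hub_xz (cf_hub' cf))).
- exact: rev_path_rcons ssym _ _ _ e2.
- by rewrite s10; perm_tac.
Qed.

(** The split lets the cycle through [s1] and [s2] make a detour to [Z] inside the hub, between [z]
    and [t]. *)
Lemma config_first_p_splits D x y z D' x' y' z' s1 s2 Z p t :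
  config D x y z D' x' y' z' s1 s2 (Z :: p) ->
  soft Z t -> splits D t x y z -> False.
Proof.
move=> cf Zt [l1 [l2 [pD h1 h2]]]; have [e1 e2 /= /andP[zZ _]] := config_soft cf.
have ZS : path (@soft G) z (rcons [:: Z] t) by rewrite /= zZ Zt.
apply: (@config_no_span D x y z D' x' y' z' s1 s2 [:: Z] p _ _ _ _ cf isT).
- exact: spans_link (spans_link h2 ZS h1) e2 (hub_xy (cf_hub' cf)).
- exact: rev_path_rcons ssym _ _ _ e1.
- perm_tac.
Qed.

Lemma config_first_p D x y z D' x' y' z' s1 s2 Z p :
  config D x y z D' x' y' z' s1 s2 (Z :: p) -> {in D, forall t, soft Z t -> t = z}.
Proof.
move=> cf t tD Zt; apply/eqP/negPn/negP => tz.
case: (hub_nz (cf_hub cf) tD tz) => h; first exact: config_first_p_splits cf Zt h.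
exact: config_first_p_splits (config_flip cf) Zt h.
Qed.

(** Leaving the hub at [z] instead of [y], a cycle could pass through [Z] to [Y] and go on along
    [s1], gaining [Z]. *)
Lemma config_first_p_s1 D x y z D' x' y' z' Y s1 s2 Z p :
  config D x y z D' x' y' z' (Y :: s1) s2 (Z :: p) -> ~~ soft Y Z.
Proof.
move=> cf; apply/negP => YZ; have [/= /andP[_ e1] e2 /= /andP[zZ _]] := config_soft cf.
have ZS : path (@soft G) z (rcons [:: Z] Y) by rewrite /= zZ ssym YZ.
apply: (@config_no_span D x y z D' x' y' z' (Y :: s1) s2 [:: Z] p _ _ _ _ cf isT).
- apply: spans_link (spans_link (hub_xz (cf_hub cf)) ZS (spans1 _ Y)) e1 _.
  exact: spans_sym ssym _ _ _ (hub_xy (cf_hub' cf)).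
- exact: rev_path_rcons ssym _ _ _ e2.
- perm_tac.
Qed.

(** The soft pair [Y], [t] suffices for [hub_add], while the true edge from [y] to [Y] keeps the hub
    connected in [G]. *)
Lemma config_grow1 D x y z D' x' y' z' Y s1 s2 p t :
  config D x y z D' x' y' z' (Y :: s1) s2 p -> t \in D -> t != y -> soft Y t ->
  config (Y :: D) x Y z D' x' y' z' s1 s2 p.
Proof.
case=> hD hD' /andP[cy cz] cD' /andP[yY h1] h2 hp p0 u sz tD ty Yt.
have /andP[_ yD] := spans_mem (hub_xy hD).
have sub : [set v in D] \subset [set v in Y :: D].
  by apply/subsetP => v; rewrite !inE => ->; rewrite orbT.
split=> //.
- by apply: (hub_add ssym hD _ tD ty); [exact: adj_soft|rewrite ssym].
- rewrite (connect_adj_inS sub cz) andbT.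
  apply: connect_trans (connect_adj_inS sub cy) _.
  by apply: connect_adj_in1; rewrite ?inE ?yD ?eqxx ?orbT.
- by move: u; congr (is_true _); apply: perm_uniq; perm_tac.
- by rewrite -sz; apply: perm_size; perm_tac.
Qed.

Lemma config_grow2 D x y z D' x' y' z' Y s1 X s2 p :
  config D x y z D' x' y' z' (Y :: s1) (X :: s2) p -> soft X Y ->
  config (X :: Y :: D) X Y z D' x' y' z' s1 s2 p.
Proof.
case=> hD hD' /andP[cy cz] cD' /andP[yY h1] /andP[xX h2] hp p0 u sz XY.
have /andP[xD yD] := spans_mem (hub_xy hD).
have sub : [set v in D] \subset [set v in X :: Y :: D].
  by apply/subsetP => v; rewrite !inE => ->; rewrite !orbT.
have Xc v : connect (adj_in [set v in D]) x v -> connect (adj_in [set v in X :: Y :: D]) X v.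
  move=> /(connect_adj_inS sub); apply: connect_trans.
  by apply: connect_adj_in1; rewrite ?inE ?xD ?eqxx ?orbT // adj_sym.
split=> //.
- by apply: (hub_add2 ssym hD) => //; exact: adj_soft.
- rewrite (Xc z cz) andbT; apply: connect_trans (Xc y cy) _.
  by apply: connect_adj_in1; rewrite ?inE ?yD ?eqxx ?orbT.
- by move: u; congr (is_true _); apply: perm_uniq; perm_tac.
- by rewrite -sz; apply: perm_size; perm_tac.
Qed.

(** Since no configuration has shorter [s1] and [s2] in total, the hub cannot grow. This gives the
    non-soft pairs and unique soft neighbours that [degree_sum_of_three_terminals] asks for at [X]
    and [Y]; for [Z] they come from the bound [M]. *)
Lemma config_degree_sum D x y z D' x' y' z' s1 s2 p :
  config D x y z D' x' y' z' s1 s2 p ->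
  (forall E u v w E' u' v' w' t1 t2 q, size t1 + size t2 < size s1 + size s2 ->
     ~ config E u v w E' u' v' w' t1 t2 q) ->
  exists g h, [/\ g \in D, h \in D, g != h & #|G| <= degree g + degree h].
Proof.
move=> cf IH.
case: s1 cf IH => [/config_s1//|Y s1] cf IH.
case: s2 cf IH => [/config_flip/config_s1//|X s2] cf IH.
case: p cf IH => [/cf_p0//|Z p] cf IH.
have uX t : t \in D -> soft X t -> t = x.
  move=> tD Xt; apply/eqP/negPn/negP => tx.
  by case: (IH _ _ _ _ _ _ _ _ _ _ _ _ (config_grow1 (config_flip cf) tD tx Xt)); rewrite /=; lia.
have uY t : t \in D -> soft Y t -> t = y.
  move=> tD Yt; apply/eqP/negPn/negP => ty.
  by case: (IH _ _ _ _ _ _ _ _ _ _ _ _ (config_grow1 cf tD ty Yt)); rewrite /=; lia.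
have XY : ~~ soft X Y.
  by apply/negP => /(config_grow2 cf) /IH; apply; rewrite /=; lia.
have /andP[xD yD] := spans_mem (hub_xy (cf_hub cf)).
have /andP[_ zD] := spans_mem (hub_xz (cf_hub cf)).
have /andP[cy cz] := cf_conn cf.
have /andP[xX _] := cf_s2 cf; have /andP[yY _] := cf_s1 cf; have /andP[zZ _] := cf_p cf.
have u := cf_uniq cf.
have notD v : v \in D' ++ (Y :: s1) ++ (X :: s2) ++ Z :: p -> v \notin D.
  by move: u; rewrite cat_uniq => /and3P[_ /hasPn hD _] /hD.
have [XD YD ZD] : [/\ X \notin D, Y \notin D & Z \notin D].
  by split; apply: notD; rewrite !(mem_cat, inE) eqxx ?orbT.
have [nXY nXZ nYZ] : [/\ X != Y, X != Z & Y != Z].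
  have u3 : uniq [:: Y; X; Z].
    apply: subseq_uniq u; do 2! apply: subseq_trans (suffix_subseq _ _).
    rewrite (_ : [:: Y; X; Z] = [:: Y] ++ [:: X] ++ [:: Z]) //.
    by rewrite !cat_subseq // sub1seq mem_head.
  by move: u3; rewrite /= !inE negb_or (eq_sym Y X) => /and3P[/andP[-> ->] ->].
have [g [h [gD hD gh dgh]]] : exists g h, [/\ g \in [set v in D], h \in [set v in D],
    g != h & #|G| <= degree g + degree h].
  apply: (@degree_sum_of_three_terminals G _ x y z X Y Z); rewrite ?inE //.
  - exact: config_first_p_s1 (config_flip cf).
  - exact: config_first_p_s1 cf.
  - by move=> t; rewrite inE; exact: uX.
  - by move=> t; rewrite inE; exact: uY.
  - by move=> t; rewrite inE; exact: (config_first_p cf).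
by exists g, h; rewrite !inE in gD hD.
Qed.

(** The cycle runs from [z] to [a], over to [b], on to [x'], back along [s2] to [x], to [y], along
    [s1] to [y'], to [z'] and back along [p]. *)
Lemma config_cross_zx D x y z D' x' y' z' s1 s2 p a b :
  config D x y z D' x' y' z' s1 s2 p -> soft a b ->
  splits D a z x y -> splits D' b x' y' z' -> False.
Proof.
move=> cf ab [l1 [l2 [pD h1 h2]]] [m1 [m2 [pD' k1 k2]]].
have [e1 e2 ep] := config_soft cf.
have cf0 : config D x y z D' x' y' z' s1 s2 (p ++ [::]) by rewrite cats0.
have ab1 : path (@soft G) a (rcons [::] b) by rewrite /= ab.
apply: (config_no_span cf0 (cf_p0 cf)).
- apply: spans_link (spans_link (spans_link (spans_sym ssym h1) ab1 k1) _ h2) e1 k2.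
  exact: rev_path_rcons ssym _ _ _ e2.
- exact: rev_path_rcons ssym _ _ _ ep.
- perm_tac.
Qed.

(** The cycle runs from [z] to [y], along [s1] to [y'], to [b], over to [a], on to [x], along [s2]
    to [x'], to [z'] and back along [p]. *)
Lemma config_cross_xy D x y z D' x' y' z' s1 s2 p a b :
  config D x y z D' x' y' z' s1 s2 p -> soft a b ->
  splits D a x y z -> splits D' b y' x' z' -> False.
Proof.
move=> cf ab [l1 [l2 [pD h1 h2]]] [m1 [m2 [pD' k1 k2]]].
have [e1 e2 ep] := config_soft cf.
have cf0 : config D x y z D' x' y' z' s1 s2 (p ++ [::]) by rewrite cats0.
have ba : path (@soft G) b (rcons [::] a) by rewrite /= ssym ab.
apply: (config_no_span cf0 (cf_p0 cf)).
- exact: spans_link (spans_link (spans_link (spans_sym ssym h2) e1 (spans_sym ssym k1)) ba h1) e2 k2.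
- exact: rev_path_rcons ssym _ _ _ ep.
- perm_tac.
Qed.

(** A spanning path from a vertex to itself is trivial, so two equal ports would leave only one
    vertex in [D]. *)
Lemma hub_ports_distinct D x y z g h :
  hub D x y z -> uniq D -> g \in D -> h \in D -> g != h ->
  [/\ x != y, x != z & y != z].
Proof.
case=> xy xz yz _ _ _ u gD hD gh.
have aux v : spans D v v -> False.
  by move/(spans_id u) => E; move: gD hD gh; rewrite E !inE => /eqP-> /eqP->; rewrite eqxx.
split; apply/eqP => E; apply: (aux x).
- by rewrite {2}E.
- by rewrite {2}E.
- by move: xy; rewrite E => /spans_sym; case: (aux z); rewrite -{1}E.
Qed.

(** A split at a vertex links it to one port, and splits at [a] and [b] to non-corresponding ports
    close too long a cycle. A vertex that is no port has splits to at least two ports; a port has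
    one to itself or else to both others. Hence only corresponding ports remain. *)
Lemma config_soft_edge D x y z D' x' y' z' s1 s2 p a b :
  config D x y z D' x' y' z' s1 s2 p ->
  [/\ x != y, x != z & y != z] -> [/\ x' != y', x' != z' & y' != z'] ->
  a \in D -> b \in D' -> soft a b ->
  [\/ a = x /\ b = x', a = y /\ b = y' | a = z /\ b = z'].
Proof.
move=> cf [xy xz yz] [xy' xz' yz'] aD bD ab.
have ba : soft b a by rewrite ssym.
have cs := config_swap cf.
(* [n1] to [n6] exclude the six ordered choices of two non-corresponding ports. *)
have n1 := config_cross_zx cf ab.
have n2 := config_cross_xy cf ab.
have n3 : splits D a z x y -> ~ splits D' b y' x' z'.
  by move=> /(splits_rev ssym); exact: config_cross_zx (config_flip cf) ab.
have n4 := config_cross_xy (config_flip cf) ab.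
have n5 := config_cross_zx cs ba.
have n6 : splits D' b z' x' y' -> ~ splits D a y x z.
  by move=> /(splits_rev ssym); exact: config_cross_zx (config_flip cs) ba.
have := hub_zx (cf_hub cf) aD; have := hub_zy (cf_hub cf) aD; have := hub_nz (cf_hub cf) aD.
have := hub_zx (cf_hub' cf) bD; have := hub_zy (cf_hub' cf) bD; have := hub_nz (cf_hub' cf) bD.
have port (c u v w : G) : u != v -> u != w -> v != w ->
   [\/ [/\ c = u, c != v & c != w], [/\ c = v, c != u & c != w],
       [/\ c = w, c != u & c != v] | [/\ c != u, c != v & c != w]].
  move=> uv uw vw; have [->|cu] := eqVneq c u; first by constructor 1.
  have [->|cv] := eqVneq c v; first by constructor 2; split=> //; rewrite eq_sym.
  by have [->|cw] := eqVneq c w; [constructor 3; split=> //; rewrite eq_sym|constructor 4].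
case: (port a x y z) => // -[a1 a2 a3]; case: (port b x' y' z') => // -[b1 b2 b3] q1 q2 q3 q4 q5 q6;
  first [by constructor 1 | by constructor 2 | by constructor 3 | exfalso; tauto].
Qed.

Lemma no_config D x y z D' x' y' z' s1 s2 p : ~ config D x y z D' x' y' z' s1 s2 p.
Proof.
have [n] := ubnP (size s1 + size s2).
elim: n D x y z D' x' y' z' s1 s2 p => // n IH D x y z D' x' y' z' s1 s2 p sn cf.
have IH' E u v w E' u' v' w' t1 t2 q : size t1 + size t2 < size s1 + size s2 ->
    ~ config E u v w E' u' v' w' t1 t2 q.
  by move=> lt; apply: IH; apply: leq_trans lt _.
have [g [h [gD hD gh dgh]]] := config_degree_sum cf IH'.
have [|g' [h' [gD' hD' gh' dgh']]] := config_degree_sum (config_swap cf).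
  by rewrite !size_rev.
have := cf_uniq cf; rewrite catA cat_uniq cat_uniq => /andP[/and3P[uD dis uD'] _].
have P := hub_ports_distinct (cf_hub cf) uD gD hD gh.
have P' := hub_ports_distinct (cf_hub' cf) uD' gD' hD' gh'.
have ne a b : a \in D -> b \in D' -> a != b.
  by move=> aD bD; apply: contraNneq (hasPn dis b bD) => <-.
have edge a b : a \in D -> b \in D' -> #|G| <= degree a + degree b ->
    [\/ a = x /\ b = x', a = y /\ b = y' | a = z /\ b = z'].
  move=> aD bD dab; apply: (config_soft_edge cf P P' aD bD).
  by apply: degree_soft dab; exact: ne.
have fun1 a b b' : a \in D -> b \in D' -> b' \in D' -> #|G| <= degree a + degree b ->
    #|G| <= degree a + degree b' -> b = b'.
  move=> aD bD bD' /(edge a b aD bD) k1 /(edge a b' aD bD') k2.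
  case: P => /eqP n1 /eqP n2 /eqP n3.
  by case: k1 => -[ea eb]; case: k2 => -[ea' eb']; congruence.
have fun2 a a' b : a \in D -> a' \in D -> b \in D' -> #|G| <= degree a + degree b ->
    #|G| <= degree a' + degree b -> a = a'.
  move=> aD aD' bD /(edge a b aD bD) k1 /(edge a' b aD' bD) k2.
  case: P' => /eqP n1 /eqP n2 /eqP n3.
  by case: k1 => -[ea eb]; case: k2 => -[ea' eb']; congruence.
move/eqP: gh; move/eqP: gh'.
(* The four degrees sum to at least [2 * #|G|], so one of the pairs [g g'], [h h'] and one of
   [g h'], [h g'] reach [#|G|]. These two pairs share a vertex, against [fun1] or [fun2]. *)
have [d1|d1] := leqP #|G| (degree g + degree g').
  have [d2|d2] := leqP #|G| (degree g + degree h').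
    by move=> + _; apply; exact: (fun1 g).
  by move=> _; apply; apply: (fun2 _ _ g') => //; lia.
have [d2|d2] := leqP #|G| (degree g + degree h').
  by move=> _; apply; apply: (fun2 _ _ h') => //; lia.
by move=> + _; apply; apply: (fun1 h) => //; lia.
Qed.

End Configurations.

(** * Cycles and ears in 2-connected graphs *)

Section TwoConnected.

Variable G : sgraph.
Implicit Types (W : {set G}) (a b d t u v : G).

Lemma connect_upath W a b :
  a \in W -> connect (adj_in W) a b ->
  exists q, [/\ path (@adj G) a q, last a q = b, uniq (a :: q) & {subset a :: q <= W}].
Proof.
move=> aW /connectP[q0 pq0 ->]; case/shortenP: pq0 => q pq uq _.
exists q; split=> //; first by apply: sub_path pq => u v /and3P[].
elim: q a aW pq {uq} => [|c q IH] a aW /= => [_ v|/andP[/and3P[_ cW _] pq] v].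
  by rewrite inE => /eqP->.
by rewrite inE => /predU1P[->//|]; exact: IH.
Qed.

Lemma connect_neighbour W a b :
  connect (adj_in W) a b -> a != b -> exists2 d, d \in W & adj a d.
Proof.
move=> /connectP[[|d q] /= + ->]; first by rewrite eqxx.
by case/andP=> /and3P[_ dW ad] _ _; exists d.
Qed.

Hypothesis hconn : k_connected 2 G.

Lemma two_connected_del v a b : a != v -> b != v -> connect (adj_in (~: [set v])) a b.
Proof. by move=> av bv; apply: (proj2 hconn); rewrite ?cards1 // !inE. Qed.

Lemma two_connected_connect a b : connect (adj_in (~: set0)) a b.
Proof. by apply: (proj2 hconn); rewrite ?cards0 ?inE. Qed.

(** A vertex [a] with neighbour [d] keeps a neighbour [d'] when [d] is deleted; a path from [d] to
    [d'] that avoids [a] closes the cycle. *)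
Lemma two_connected_cycle : exists2 c, ucycle (@adj G) c & 2 < size c.
Proof.
have [a [b [c [_ [ab bc ca]]]]] := card_gt2P (proj1 hconn).
have [d _ ad] := connect_neighbour (two_connected_connect a b) ab.
have da : d != a by apply: contraTneq ad => ->; rewrite adj_irr.
have [t ta td] : exists2 t, t != a & t != d.
  by have [<-|bd] := eqVneq b d; [exists c; rewrite // eq_sym|exists b; rewrite // eq_sym].
have [||d'] := connect_neighbour (two_connected_del (a := a) (v := d) _ td).
- by rewrite eq_sym.
- by rewrite eq_sym.
rewrite !inE => dd' ad'.
have da' : d' != a by apply: contraTneq ad' => ->; rewrite adj_irr.
have [|q [pq lq uq sq]] := connect_upath _ (two_connected_del da da').
  by rewrite !inE.
exists (a :: d :: q).
  rewrite /ucycle [cycle _ _]/= ad rcons_path pq lq adj_sym ad' cons_uniq uq !andbT.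
  by apply/negP => /sq; rewrite !inE eqxx.
by case: q lq {pq uq sq} => //= E; rewrite E eqxx in dd'.
Qed.

(** Walk to [h] and leave [C] for the last time at [u]; delete [u], walk again and leave [C] at [v].
    Both exits reach [h] outside [C], hence each other. *)
Lemma two_connected_ear (C : {set G}) a b h :
  a \in C -> b \in C -> a != b -> h \notin C ->
  exists u v p, [/\ u \in C, v \in C, u != v, path (@adj G) u (rcons p v) &
    [/\ 0 < size p, uniq p & {subset p <= ~: C}]].
Proof.
move=> aC bC ab hC.
have [u [u1 []]] := last_exit (two_connected_connect a h) aC hC.
rewrite !inE => /andP[uC _] /andP[u1C _] uu1 cu1.
have [c cC cu] : exists2 c, c \in C & c != u.
  by have [<-|] := eqVneq a u; [exists b; rewrite // eq_sym|exists a].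
have hu : h != u by apply: contraNneq hC => ->.
have [v [v1 []]] := last_exit (two_connected_del cu hu) cC hC.
rewrite !inE => /andP[vC vu] /andP[v1C _] vv1 cv1.
have sub W : W :\: C \subset ~: C by apply/subsetP => w; rewrite !inE => /andP[].
have [||q [pq lq uq sq]] := @connect_upath (~: C) u1 v1.
- by rewrite inE.
- apply: connect_trans (connect_adj_inS (sub _) cu1) _.
  by rewrite connect_adj_in_sym; exact: connect_adj_inS (sub _) cv1.
exists u, v, (u1 :: q); split=> //; first by rewrite eq_sym.
by rewrite /= uu1 rcons_path pq lq adj_sym.
Qed.

End TwoConnected.

(** * Hamiltonicity, from a longest cycle and the configuration it starts *)

Theorem theorem7 (G : sgraph) (hconn : k_connected 2 G)
  (hclaw : claw_o_heavy G) (hnet : c_heavy net G) : hamiltonian G.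
Proof.
(* The empty list and an edge walked to and fro also count here; the cycle [c0] ensures that the
   maximum exceeds 2. *)
pose P m := [exists t : m.-tuple G, ucycleb (@adj G) t].
have P_size c : ucycle (@adj G) c -> P (size c).
  by move=> cyc; apply/existsP; exists (in_tuple c).
have [c0 cyc0 c03] := two_connected_cycle hconn.
have exP : exists m, P m by exists (size c0); exact: P_size.
have boundP m : P m -> m <= #|G|.
  case/existsP=> t /andP[_ ut]; rewrite -(size_tuple t) -(card_uniqP ut).
  exact: max_card.
case: (ex_maxnP exP boundP) => M /existsP[t cyct] maxM.
have M3 : 2 < M by apply: leq_trans c03 (maxM _ (P_size _ cyc0)).
have M_max c : ucycle (@soft G) c -> 2 < size c -> size c <= M.
  move=> cyc c3; have [c' cyc' sub] := soft_cycle_extend cyc c3.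
  apply: leq_trans (maxM _ (P_size _ cyc')); apply: uniq_leq_size sub.
  by case/andP: cyc.
have [/forallP allt|] := boolP [forall v, v \in tval t].
  by exists t; split=> //; rewrite size_tuple.
rewrite negb_forall => /existsP[h ht]; exfalso.
have [a [b [at_ bt ab]]] : exists a b, [/\ a \in tval t, b \in tval t & a != b].
  case: (tval t) (size_tuple t) cyct => [|a [|b s]]; rewrite ?size_tuple //=; try lia.
  move=> _ /andP[_ /=]; rewrite inE negb_or -andbA => /andP[ab _].
  by exists a, b; rewrite !inE !eqxx orbT.
have [||||u [v [p [uC vC uv pp [p0 up sp]]]]] :=
  @two_connected_ear G hconn [set w in tval t] a b h; rewrite ?inE //.
rewrite !inE in uC vC.
case/andP: cyct => cyct ut; have [i s tE] := rot_to uC.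
have vs : v \in s by move: vC; rewrite -(mem_rot i) tE inE eq_sym (negbTE uv).
have us : uniq (u :: s) by rewrite -tE rot_uniq.
have szs : size (u :: s) = M by rewrite -tE size_rot size_tuple.
have ms : u :: s =i tval t by move=> w; rewrite -tE mem_rot.
move: cyct; rewrite -(rot_cycle i) tE /= => cycs.
case/splitPr: vs us szs ms cycs => A B us szs ms.
rewrite rcons_cat cat_path /= => /and3P[pA lAv pB].
(* The arc [B] leads from [v] back to [u], so it is reversed to run from the hub at [u] to the hub
   at [v]. *)
apply: (@no_config G M M3 M_max hclaw hnet [:: u] u u u [:: v] v v v A (rev B) p).
split; rewrite ?connect0 //; try exact: hub1.
- by rewrite rcons_path pA.
- exact: rev_path_rcons (@adj_sym G) _ _ _ pB.
- have pE : perm_eq ([:: u] ++ [:: v] ++ A ++ rev B ++ p) ((u :: A ++ v :: B) ++ p).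
    by perm_tac.
  rewrite (perm_uniq pE) cat_uniq us up andbT; apply/hasPn => w /sp.
  by rewrite !inE -ms inE.
- by rewrite -szs; apply: perm_size; perm_tac.
Qed.
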